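(* Consider the planar quadratic system with real coefficients $$\dot x=a_1x+a_2y+a_3x^2+a_4y^2+a_5xy,\qquad \dot y=b_1x+b_2y+b_3x^2+b_4y^2+b_5xy,$$ and let $k>0$. The curves $y=mx^k$ (for any $m\in\mathbb{R}$) are invariant under the flow of the system if and only if $$b_1=b_3=a_4=a_2=0,\quad b_4=ka_5,\quad b_5=ka_3\quad\text{and}\quad b_2=ka_1.$$
   Context: A set $S\subseteq\mathbb{R}^2$ is invariant under the flow $\Phi_t$ of a planar system if $\Phi_t(X_0)\in S$ for every $X_0\in S$ and every $t$ in the maximal interval of existence $I(X_0)$ of the solution with initial value $X_0$. The left-hand side of the equivalence means that all the curves of the family, i.e. $y=mx^k$ for every $m\in\mathbb{R}$, are invariant. *)

(* Defs.v *)
From Stdlib Require Import Reals.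
From Coquelicot Require Import Coquelicot.
Open Scope R_scope.

(** Open intervals ]a, b[, with possibly infinite end points. *)
Definition in_interval (a b : Rbar) (t : R) : Prop :=
  Rbar_lt a t /\ Rbar_lt t b.

Definition solution (F : R * R -> R * R) (X0 : R * R) (a b : Rbar)
    (phi : R -> R * R) : Prop :=
  in_interval a b 0 /\
  phi 0 = X0 /\
  forall t : R, in_interval a b t ->
    is_derive (fun s => fst (phi s)) t (fst (F (phi t))) /\
    is_derive (fun s => snd (phi s)) t (snd (F (phi t))).

(** ]a, b[ is the maximal interval of existence I(X0), and [phi t] is the value
    of the flow at time [t] started from [X0].  The values of [phi] outside
    ]a, b[ are irrelevant. *)
Definition maximal_solution (F : R * R -> R * R) (X0 : R * R) (a b : Rbar)
    (phi : R -> R * R) : Prop :=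
  solution F X0 a b phi /\
  forall (a' b' : Rbar) (psi : R -> R * R),
    solution F X0 a' b' psi ->
    Rbar_le a' a -> Rbar_le b b' ->
    (forall t : R, in_interval a b t -> psi t = phi t) ->
    a' = a /\ b' = b.

Definition flow_invariant (F : R * R -> R * R) (S : R * R -> Prop) : Prop :=
  forall (X0 : R * R) (a b : Rbar) (phi : R -> R * R),
    S X0 -> maximal_solution F X0 a b phi ->
    forall t : R, in_interval a b t -> S (phi t).

Definition quadratic_field (a1 a2 a3 a4 a5 b1 b2 b3 b4 b5 : R) (X : R * R)
    : R * R :=
  let (x, y) := X in
  (a1 * x + a2 * y + a3 * x ^ 2 + a4 * y ^ 2 + a5 * x * y,
   b1 * x + b2 * y + b3 * x ^ 2 + b4 * y ^ 2 + b5 * x * y).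

(** [is_power x k z]: the real power x^k, for k > 0, is defined and equal to z.
    Stdlib's [Rpower] is meaningful only for a positive base.  A negative base
    is allowed exactly when k = p / q with q odd (in particular for every
    integer k); then x^k is the unique real z with z^q = x^p, which does not
    depend on the chosen fraction. *)
Definition is_power (x k z : R) : Prop :=
  (0 < x /\ z = Rpower x k) \/
  (x = 0 /\ z = 0) \/
  (x < 0 /\ exists p q : nat,
     Nat.Odd q /\ k * INR q = INR p /\ z ^ q = x ^ p).

(** The curve y = m x^k over the whole real domain of x^k. *)
Definition power_curve (m k : R) (X : R * R) : Prop :=
  exists z : R, is_power (fst X) k z /\ snd X = m * z.

(* Main.v *)
Require Import Defs.
From Stdlib Require Import Reals Psatz ClassicalEpsilon.
From Coquelicot Require Import Coquelicot.
Open Scope R_scope.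

(** If the conditions hold, the system is [x' = x g], [y' = k y g] with
    [g = a1 + a3 x + a5 y], so with [G] the integral of [g] along a solution
    [x = x0 e^G] and [y = y0 e^(kG)]: the relation [y = m x^k] persists.

    Conversely, differentiating [y = m x^k] at time 0 along the solution through
    [(x, m x^k)] gives [x y' = k y x']; for [x = 1] and [x = 2] both sides are
    cubic polynomials in [m], whose coefficients give the conditions.  This needs
    a maximal solution through each point: power series with geometrically
    bounded coefficients solve the system locally, and by uniqueness (Gronwall)
    all solutions with a given initial value glue together. *)

(** * Local existence by power series *)

Definition quad (c1 c2 c3 c4 c5 x y : R) : R :=
  c1 * x + c2 * y + c3 * x ^ 2 + c4 * y ^ 2 + c5 * x * y.

Definition quad_coef (c1 c2 c3 c4 c5 : R) (x y : nat -> R) (n : nat) : R :=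
  c1 * x n + c2 * y n + c3 * PS_mult x x n + c4 * PS_mult y y n
  + c5 * PS_mult x y n.

Lemma PSeries_quad_coef c1 c2 c3 c4 c5 x y t :
  Rbar_lt (Rabs t) (CV_radius x) -> Rbar_lt (Rabs t) (CV_radius y) ->
  PSeries (quad_coef c1 c2 c3 c4 c5 x y) t
  = quad c1 c2 c3 c4 c5 (PSeries x t) (PSeries y t).
Proof.
  intros hx hy.
  rewrite (PSeries_ext _
    (PS_plus (PS_plus (PS_plus (PS_plus (PS_scal c1 x) (PS_scal c2 y))
      (PS_scal c3 (PS_mult x x))) (PS_scal c4 (PS_mult y y)))
      (PS_scal c5 (PS_mult x y)))) by reflexivity.
  assert (scal_ex : forall (c : R) (a : nat -> R),
    ex_pseries a t -> ex_pseries (PS_scal c a) t)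
    by (intros c a; apply ex_pseries_scal, Rmult_comm).
  rewrite !PSeries_plus, !PSeries_scal, !PSeries_mult;
    try solve [trivial | repeat match goal with
      | |- ex_pseries (PS_plus _ _) _ => apply ex_pseries_plus
      | |- ex_pseries (PS_scal _ _) _ => apply scal_ex
      | |- ex_pseries (PS_mult _ _) _ => now apply ex_pseries_mult
      | |- _ => now apply CV_radius_inside
      end; trivial].
  unfold quad; ring.
Qed.

Lemma PS_mult_ext (x y x' y' : nat -> R) n :
  (forall j, (j <= n)%nat -> x j = x' j /\ y j = y' j) ->
  PS_mult x y n = PS_mult x' y' n.
Proof.
  intros e; unfold PS_mult; apply sum_eq; intros j hj.
  now rewrite (proj1 (e j hj)), (proj2 (e (n - j)%nat ltac:(lia))).
Qed.

Lemma quad_coef_ext c1 c2 c3 c4 c5 x y x' y' n :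
  (forall j, (j <= n)%nat -> x j = x' j /\ y j = y' j) ->
  quad_coef c1 c2 c3 c4 c5 x y n = quad_coef c1 c2 c3 c4 c5 x' y' n.
Proof.
  intros e; unfold quad_coef.
  destruct (e n (le_n n)) as [-> ->].
  rewrite (PS_mult_ext x y x' y'), (PS_mult_ext x x x' x'),
    (PS_mult_ext y y y' y'); trivial; intros j hj; now split; apply e.
Qed.

(** Each of the n + 1 products in the Cauchy product is at most (M r^j)(M r^(n-j)) = M^2 r^n. The
    factor [INR (S n)] is harmless: the recurrence for the Taylor coefficients divides by it. *)
Lemma PS_mult_geometric_bound (x y : nat -> R) M r n : 0 <= r ->
  (forall j, (j <= n)%nat -> Rabs (x j) <= M * r ^ j /\ Rabs (y j) <= M * r ^ j) ->
  Rabs (PS_mult x y n) <= INR (S n) * (M ^ 2 * r ^ n).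
Proof.
  intros hr B; unfold PS_mult.
  eapply Rle_trans; [apply Rsum_abs|].
  rewrite Rmult_comm, <- sum_cte.
  apply sum_Rle; intros j hj.
  rewrite Rabs_mult.
  replace (M ^ 2 * r ^ n) with ((M * r ^ j) * (M * r ^ (n - j))).
  - apply Rmult_le_compat; try apply Rabs_pos; apply B; lia.
  - replace n with (j + (n - j))%nat at 2 by lia.
    rewrite pow_add; ring.
Qed.

(** Two linear and three quadratic terms are estimated separately. The linear ones are weakened by
    the factor n + 1 so that all five bounds have the same shape. *)
Lemma quad_coef_geometric_bound c1 c2 c3 c4 c5 A x y M r n :
  0 <= r -> 0 <= A ->
  Rabs c1 <= A -> Rabs c2 <= A -> Rabs c3 <= A -> Rabs c4 <= A -> Rabs c5 <= A ->
  (forall j, (j <= n)%nat -> Rabs (x j) <= M * r ^ j /\ Rabs (y j) <= M * r ^ j) ->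
  Rabs (quad_coef c1 c2 c3 c4 c5 x y n)
  <= INR (S n) * ((2 * A * M + 3 * A * M ^ 2) * r ^ n).
Proof.
  intros hr hA h1 h2 h3 h4 h5 B.
  assert (hn : 1 <= INR (S n)) by (rewrite S_INR; pose proof (pos_INR n); lra).
  pose proof (PS_mult_geometric_bound x x M r n hr
    (fun j hj => conj (proj1 (B j hj)) (proj1 (B j hj)))) as Bxx.
  pose proof (PS_mult_geometric_bound y y M r n hr
    (fun j hj => conj (proj2 (B j hj)) (proj2 (B j hj)))) as Byy.
  pose proof (PS_mult_geometric_bound x y M r n hr B) as Bxy.
  destruct (B n (le_n n)) as [Bx By].
  assert (lin : forall u, Rabs u <= M * r ^ n -> Rabs u <= INR (S n) * (M * r ^ n)).
  { intros u hu; pose proof (Rabs_pos u); nra. }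
  assert (term : forall c u D, Rabs c <= A -> Rabs u <= D -> Rabs (c * u) <= A * D).
  { intros c u D hc hu; rewrite Rabs_mult.
    apply Rmult_le_compat; trivial; apply Rabs_pos. }
  pose proof (term _ _ _ h1 (lin _ Bx)) as t1.
  pose proof (term _ _ _ h2 (lin _ By)) as t2.
  pose proof (term _ _ _ h3 Bxx) as t3.
  pose proof (term _ _ _ h4 Byy) as t4.
  pose proof (term _ _ _ h5 Bxy) as t5.
  unfold quad_coef.
  apply Rle_trans with (Rabs (c1 * x n) + Rabs (c2 * y n)
    + Rabs (c3 * PS_mult x x n) + Rabs (c4 * PS_mult y y n)
    + Rabs (c5 * PS_mult x y n)).
  { repeat (eapply Rle_trans; [apply Rabs_triang|]; apply Rplus_le_compat_r).
    apply Rle_refl. }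
  nra.
Qed.

(* Only the values at indices [<= n] of the two sequences in [quad_series n]
   are meaningful. *)
Fixpoint quad_series (a1 a2 a3 a4 a5 b1 b2 b3 b4 b5 x0 y0 : R)
    (n : nat) {struct n} : (nat -> R) * (nat -> R) :=
  match n with
  | O => (fun _ => x0, fun _ => y0)
  | S n =>
    let (x, y) := quad_series a1 a2 a3 a4 a5 b1 b2 b3 b4 b5 x0 y0 n in
    (fun j => if (j <=? n)%nat then x j
              else quad_coef a1 a2 a3 a4 a5 x y n / INR (S n),
     fun j => if (j <=? n)%nat then y j
              else quad_coef b1 b2 b3 b4 b5 x y n / INR (S n))
  end.

Lemma quad_series_stable a1 a2 a3 a4 a5 b1 b2 b3 b4 b5 x0 y0 n j :
  let c := quad_series a1 a2 a3 a4 a5 b1 b2 b3 b4 b5 x0 y0 in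
  (j <= n)%nat -> fst (c n) j = fst (c j) j /\ snd (c n) j = snd (c j) j.
Proof.
  cbn zeta; induction 1 as [|n h IH]; [now split|].
  rewrite <- (proj1 IH), <- (proj2 IH); simpl.
  destruct (quad_series _ _ _ _ _ _ _ _ _ _ _ _ n) as [x y]; simpl.
  now apply Nat.leb_le in h as ->.
Qed.

(** The diagonal of the stages works: stage n agrees with it up to index n, and the n-th coefficient
    of the field reads no index beyond n. *)
Lemma quad_series_exists a1 a2 a3 a4 a5 b1 b2 b3 b4 b5 x0 y0 :
  exists x y : nat -> R, x O = x0 /\ y O = y0 /\
  forall n, x (S n) = quad_coef a1 a2 a3 a4 a5 x y n / INR (S n) /\
            y (S n) = quad_coef b1 b2 b3 b4 b5 x y n / INR (S n).
Proof.
  set (c := quad_series a1 a2 a3 a4 a5 b1 b2 b3 b4 b5 x0 y0).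
  exists (fun j => fst (c j) j), (fun j => snd (c j) j).
  split; [easy|split; [easy|]]; intros n.
  pose proof (quad_series_stable a1 a2 a3 a4 a5 b1 b2 b3 b4 b5 x0 y0 n)
    as stable; fold c in stable.
  rewrite <- (quad_coef_ext a1 a2 a3 a4 a5 _ _ _ _ n stable).
  rewrite <- (quad_coef_ext b1 b2 b3 b4 b5 _ _ _ _ n stable).
  unfold c; cbn [quad_series].
  destruct (quad_series _ _ _ _ _ _ _ _ _ _ _ _ n) as [x y]; cbn [fst snd].
  rewrite (proj2 (Nat.leb_gt (S n) n)) by lia; now split.
Qed.

(** The formal Taylor coefficients are bounded by M r^n, by induction on n, so both series converge
    on ]-1/r, 1/r[ and may be differentiated and multiplied termwise there. *)
Lemma quad_local_solution (a1 a2 a3 a4 a5 b1 b2 b3 b4 b5 : R) (X0 : R * R) :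
  exists (a b : Rbar) (phi : R -> R * R),
    solution (quadratic_field a1 a2 a3 a4 a5 b1 b2 b3 b4 b5) X0 a b phi.
Proof.
  destruct X0 as [x0 y0].
  destruct (quad_series_exists a1 a2 a3 a4 a5 b1 b2 b3 b4 b5 x0 y0)
    as (x & y & hx0 & hy0 & rec).
  set (A := Rabs a1 + Rabs a2 + Rabs a3 + Rabs a4 + Rabs a5
            + Rabs b1 + Rabs b2 + Rabs b3 + Rabs b4 + Rabs b5).
  assert (hA : 0 <= A /\
    (Rabs a1 <= A /\ Rabs a2 <= A /\ Rabs a3 <= A /\ Rabs a4 <= A /\ Rabs a5 <= A) /\
    (Rabs b1 <= A /\ Rabs b2 <= A /\ Rabs b3 <= A /\ Rabs b4 <= A /\ Rabs b5 <= A)).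
  { unfold A; pose proof (Rabs_pos a1); pose proof (Rabs_pos a2);
    pose proof (Rabs_pos a3); pose proof (Rabs_pos a4); pose proof (Rabs_pos a5);
    pose proof (Rabs_pos b1); pose proof (Rabs_pos b2); pose proof (Rabs_pos b3);
    pose proof (Rabs_pos b4); pose proof (Rabs_pos b5); lra. }
  destruct hA as (hA & (ha1 & ha2 & ha3 & ha4 & ha5) & hb1 & hb2 & hb3 & hb4 & hb5).
  clearbody A.
  set (M := Rabs x0 + Rabs y0).
  assert (hM : 0 <= M /\ Rabs x0 <= M /\ Rabs y0 <= M).
  { unfold M; pose proof (Rabs_pos x0); pose proof (Rabs_pos y0); lra. }
  destruct hM as (hM & hx0M & hy0M); clearbody M.
  (* The induction step needs 2AM + 3AM^2 <= M r; the summand 1 keeps r positive when A = 0. *)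
  set (r := 1 + 2 * A + 3 * A * M).
  assert (hr : 0 < r) by (unfold r; nra).
  assert (step : forall (c : R) n,
    Rabs c <= INR (S n) * ((2 * A * M + 3 * A * M ^ 2) * r ^ n) ->
    Rabs (c / INR (S n)) <= M * r ^ S n).
  { intros c n hc.
    assert (0 < INR (S n)) by (apply lt_0_INR; lia).
    rewrite Rabs_div by lra; rewrite (Rabs_pos_eq (INR (S n))) by lra.
    apply Rle_div_l; trivial.
    eapply Rle_trans; [apply hc|].
    rewrite (Rmult_comm (M * _)); apply Rmult_le_compat_l; [lra|].
    pose proof (pow_lt r n hr).
    replace (M * r ^ S n) with ((M * r) * r ^ n) by (simpl; ring).
    apply Rmult_le_compat_r; [lra|].
    unfold r; nra. }
  assert (B : forall n j, (j <= n)%nat ->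
    Rabs (x j) <= M * r ^ j /\ Rabs (y j) <= M * r ^ j).
  { induction n as [|n IH]; intros j hj.
    - replace j with O by lia; simpl; rewrite hx0, hy0; lra.
    - destruct (Nat.eq_dec j (S n)) as [->|]; [|apply IH; lia].
      destruct (rec n) as [-> ->].
      split; apply step; apply quad_coef_geometric_bound; trivial; lra. }
  assert (radius : forall (u : nat -> R), (forall n, Rabs (u n) <= M * r ^ n) ->
    forall t, - / r < t < / r -> Rbar_lt (Rabs t) (CV_radius u)).
  { intros u hu t ht.
    apply Rbar_lt_le_trans with (/ r).
    - apply Rabs_def1; lra.
    - apply (CV_radius_bounded u); exists M; intros n.
      rewrite Rabs_mult, (Rabs_pos_eq ((/ r) ^ n)).
      + rewrite pow_inv; apply Rle_div_l; [now apply pow_lt|apply hu].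
      + apply pow_le, Rlt_le, Rinv_0_lt_compat, hr. }
  assert (inv : 0 < / r) by now apply Rinv_0_lt_compat.
  exists (- / r), (/ r), (fun t => (PSeries x t, PSeries y t)).
  split; [split; simpl; lra|split].
  { now rewrite !PSeries_0, hx0, hy0. }
  intros t [ht1 ht2]; simpl in ht1, ht2.
  assert (rx : Rbar_lt (Rabs t) (CV_radius x))
    by (apply radius; [intros n; apply (B n n); lia|lra]).
  assert (ry : Rbar_lt (Rabs t) (CV_radius y))
    by (apply radius; [intros n; apply (B n n); lia|lra]).
  assert (der : forall u c1 c2 c3 c4 c5, Rbar_lt (Rabs t) (CV_radius u) ->
    (forall n, u (S n) = quad_coef c1 c2 c3 c4 c5 x y n / INR (S n)) ->
    is_derive (PSeries u) t (quad c1 c2 c3 c4 c5 (PSeries x t) (PSeries y t))).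
  { intros u c1 c2 c3 c4 c5 hu hrec.
    rewrite <- PSeries_quad_coef by trivial.
    rewrite <- (PSeries_ext (PS_derive u)).
    - now apply is_derive_PSeries.
    - intros n; unfold PS_derive; rewrite hrec; field.
      apply not_0_INR; lia. }
  split; apply der; trivial; intros n; apply rec.
Qed.

(** * Uniqueness of solutions *)

Lemma in_interval_between a b s t u :
  in_interval a b s -> in_interval a b t -> Rmin s t <= u <= Rmax s t ->
  in_interval a b u.
Proof.
  unfold Rmin, Rmax; intros [hs1 hs2] [ht1 ht2] hu.
  split; [destruct a as [a| |]|destruct b as [b| |]]; simpl in *; trivial;
    destruct (Rle_dec s t); lra.
Qed.

Lemma locally_in_interval a b t :
  in_interval a b t -> locally t (in_interval a b).
Proof.
  intros ht.
  exact (open_and _ _ (open_Rbar_gt a) (open_Rbar_lt b) t ht).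
Qed.

Lemma is_derive_continuity_pt f t l : is_derive f t l -> continuity_pt f t.
Proof.
  intros h; apply continuity_pt_filterlim.
  apply (ex_derive_continuous f t); now exists l.
Qed.

(** The product of N(s) and e^(-K|s|) does not increase from 0 towards t, so N(t) <= 0. A single use
    of the mean value theorem between 0 and t suffices. *)
Lemma gronwall_zero (N dN : R -> R) (t K : R) :
  (forall s, Rmin 0 t <= s <= Rmax 0 t ->
     is_derive N s (dN s) /\ Rabs (dN s) <= K * N s) ->
  N 0 = 0 -> 0 <= N t -> N t = 0.
Proof.
  intros hN N0 Npos.
  (* The sign of t, so that one computation covers forward and backward time. *)
  set (sg := if Rle_dec 0 t then 1 else -1).
  assert (hsg : sg * t = Rabs t).
  { unfold sg; destruct (Rle_dec 0 t);
      [rewrite Rabs_pos_eq|rewrite Rabs_left]; lra. }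
  clearbody sg.
  assert (der : forall s, Rmin 0 t <= s <= Rmax 0 t ->
    is_derive (fun s => N s * exp (- (sg * K * s))) s
      ((dN s - sg * K * N s) * exp (- (sg * K * s)))).
  { intros s hs; destruct (hN s hs) as [d _].
    auto_derive; [now exists (dN s)|].
    replace (Derive (fun x : R => N x) s) with (dN s)
      by (symmetry; now apply is_derive_unique).
    ring. }
  destruct (MVT_gen (fun s => N s * exp (- (sg * K * s))) 0 t
    (fun s => (dN s - sg * K * N s) * exp (- (sg * K * s)))) as (c & hc & e).
  - intros s hs; apply der; lra.
  - intros s hs; eapply is_derive_continuity_pt, der, hs.
  - cbn beta in e; rewrite N0, Rmult_0_l, !Rminus_0_r in e.
    destruct (hN c hc) as [_ bound].
    pose proof (exp_pos (- (sg * K * c))); pose proof (exp_pos (- (sg * K * t))).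
    assert (dN c * t <= K * N c * Rabs t).
    { eapply Rle_trans; [apply Rle_abs|rewrite Rabs_mult].
      apply Rmult_le_compat_r; [apply Rabs_pos|exact bound]. }
    assert ((dN c - sg * K * N c) * t <= 0) by (rewrite <- hsg in *; lra).
    nra.
Qed.

(** The squared distance [N] of the two solutions vanishes at time 0 and satisfies |N'| <= K N
    between 0 and t, because the difference of the field at two points is linear in the differences
    of the coordinates, with coefficients continuous in time. *)
Lemma quad_solution_unique a1 a2 a3 a4 a5 b1 b2 b3 b4 b5 X0 a b phi a' b' psi t :
  let F := quadratic_field a1 a2 a3 a4 a5 b1 b2 b3 b4 b5 in
  solution F X0 a b phi -> solution F X0 a' b' psi ->
  in_interval a b t -> in_interval a' b' t -> phi t = psi t.
Proof.
  cbn zeta; intros (i0 & phi0 & dphi) (i0' & psi0 & dpsi) ht ht'.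
  set (x1 := fun s => fst (phi s)); set (y1 := fun s => snd (phi s)).
  set (x2 := fun s => fst (psi s)); set (y2 := fun s => snd (psi s)).
  set (I := fun s => Rmin 0 t <= s <= Rmax 0 t).
  assert (d1 : forall s, I s -> is_derive x1 s (quad a1 a2 a3 a4 a5 (x1 s) (y1 s))
    /\ is_derive y1 s (quad b1 b2 b3 b4 b5 (x1 s) (y1 s))).
  { intros s hs; generalize (dphi s (in_interval_between _ _ _ _ _ i0 ht hs)).
    unfold x1, y1, quad; destruct (phi s); trivial. }
  assert (d2 : forall s, I s -> is_derive x2 s (quad a1 a2 a3 a4 a5 (x2 s) (y2 s))
    /\ is_derive y2 s (quad b1 b2 b3 b4 b5 (x2 s) (y2 s))).
  { intros s hs; generalize (dpsi s (in_interval_between _ _ _ _ _ i0' ht' hs)).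
    unfold x2, y2, quad; destruct (psi s); trivial. }
  (* [u' = p u + q v] for the differences [u = x1 - x2], [v = y1 - y2] *)
  set (p c1 c3 c5 s := c1 + c3 * (x1 s + x2 s) + c5 * y1 s).
  set (q c2 c4 c5 s := c2 + c4 * (y1 s + y2 s) + c5 * x2 s).
  set (N := fun s => (x1 s - x2 s) ^ 2 + (y1 s - y2 s) ^ 2).
  assert (Npos : forall s, 0 <= N s)
    by (intros s; apply Rplus_le_le_0_compat; apply pow2_ge_0).
  set (dN := fun s =>
    2 * (x1 s - x2 s) * (p a1 a3 a5 s * (x1 s - x2 s) + q a2 a4 a5 s * (y1 s - y2 s))
    + 2 * (y1 s - y2 s) * (p b1 b3 b5 s * (x1 s - x2 s) + q b2 b4 b5 s * (y1 s - y2 s))).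
  set (L := fun s => 2 * (Rabs (p a1 a3 a5 s) + Rabs (q a2 a4 a5 s)
    + Rabs (p b1 b3 b5 s) + Rabs (q b2 b4 b5 s))).
  (* K is the maximum of the continuous function [L] on the compact segment between 0 and t. *)
  assert (bound : exists K, forall s, I s -> L s <= K).
  { destruct (continuity_ab_maj L (Rmin 0 t) (Rmax 0 t)) as (m & hm & _).
    - apply Rminmax.
    - intros s hs; destruct (d1 s hs) as [dx1 dy1]; destruct (d2 s hs) as [dx2 dy2].
      apply is_derive_continuity_pt in dx1, dy1, dx2, dy2.
      unfold L, p, q.
      repeat match goal with
      | |- continuity_pt (fun s => _ + _) _ => apply @continuity_pt_plus
      | |- continuity_pt (fun s => _ * _) _ => apply @continuity_pt_mult
      | |- continuity_pt (fun s => Rabs (@?f s)) _ =>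
          apply (continuity_pt_comp f Rabs); [|apply Rcontinuity_abs]
      | |- continuity_pt (fun s => ?c) _ =>
          apply continuity_pt_const; intros ? ?; reflexivity
      end; assumption.
    - now exists (L m). }
  destruct bound as [K hK].
  assert (N t = 0).
  { apply (gronwall_zero N dN t K).
    - intros s hs; destruct (d1 s hs) as [dx1 dy1]; destruct (d2 s hs) as [dx2 dy2].
      split.
      + unfold N; auto_derive.
        * repeat split; eexists; eassumption.
        * apply is_derive_unique in dx1, dy1, dx2, dy2.
          change (fun x : R => x1 x) with x1; change (fun x : R => x2 x) with x2;
          change (fun x : R => y1 x) with y1; change (fun x : R => y2 x) with y2.
          rewrite dx1, dx2, dy1, dy2.
          unfold dN, p, q, quad; ring.
      (* Expanded, N' is a combination of u^2, uv and v^2, each at most u^2 + v^2 in absolute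
         value. *)
      + apply Rle_trans with (L s * N s).
        * unfold dN, L, N.
          generalize (x1 s - x2 s) (y1 s - y2 s) (p a1 a3 a5 s) (q a2 a4 a5 s)
            (p b1 b3 b5 s) (q b2 b4 b5 s); intros u v P Q P' Q'.
          assert (E : forall c w, Rabs w <= u ^ 2 + v ^ 2 ->
            Rabs (2 * c * w) <= 2 * Rabs c * (u ^ 2 + v ^ 2)).
          { intros c w hw; rewrite !Rabs_mult, (Rabs_pos_eq 2) by lra.
            pose proof (Rabs_pos c); nra. }
          assert (huv : Rabs (u * v) <= u ^ 2 + v ^ 2) by (apply Rabs_le; nra).
          assert (huu : Rabs (u * u) <= u ^ 2 + v ^ 2) by (apply Rabs_le; nra).
          assert (hvv : Rabs (v * v) <= u ^ 2 + v ^ 2) by (apply Rabs_le; nra).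
          replace (2 * u * (P * u + Q * v) + 2 * v * (P' * u + Q' * v))
            with (2 * P * (u * u) + 2 * Q * (u * v) + 2 * P' * (u * v)
                  + 2 * Q' * (v * v)) by ring.
          pose proof (E P _ huu); pose proof (E Q _ huv);
          pose proof (E P' _ huv); pose proof (E Q' _ hvv).
          apply Rle_trans with (Rabs (2 * P * (u * u)) + Rabs (2 * Q * (u * v))
            + Rabs (2 * P' * (u * v)) + Rabs (2 * Q' * (v * v))); [|lra].
          repeat (eapply Rle_trans; [apply Rabs_triang|]; apply Rplus_le_compat_r).
          apply Rle_refl.
        * apply Rmult_le_compat_r; [apply Npos|now apply hK].
    - unfold N, x1, x2, y1, y2; rewrite phi0, psi0; ring.
    - apply Npos. }
  assert (x1 t - x2 t = 0 /\ y1 t - y2 t = 0) as [ex ey]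
    by (apply Rplus_sqr_eq_0; rewrite !Rsqr_pow2; assumption).
  unfold x1, x2, y1, y2 in ex, ey.
  apply injective_projections; lra.
Qed.

(** * Existence of maximal solutions *)

(** The union of all solutions from [X0] is maximal. Its interval runs from the infimum to the
    supremum of the set [E] of times reached by some solution. *)
Lemma quad_maximal_solution_exists a1 a2 a3 a4 a5 b1 b2 b3 b4 b5 X0 :
  exists (a b : Rbar) (phi : R -> R * R),
    maximal_solution (quadratic_field a1 a2 a3 a4 a5 b1 b2 b3 b4 b5) X0 a b phi.
Proof.
  set (F := quadratic_field a1 a2 a3 a4 a5 b1 b2 b3 b4 b5).
  set (at_time t X := exists a b phi,
    solution F X0 a b phi /\ in_interval a b t /\ phi t = X).
  set (E t := exists X, at_time t X).
  destruct (quad_local_solution a1 a2 a3 a4 a5 b1 b2 b3 b4 b5 X0)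
    as (la & lb & lphi & lsol).
  assert (E0 : E 0).
  { exists (lphi 0), la, lb, lphi; split; [|split]; trivial; apply lsol. }
  pose proof (Lub_Rbar_correct E) as [ub lub].
  pose proof (Glb_Rbar_correct E) as [lbd glb].
  set (bs := Lub_Rbar E) in *; set (as_ := Glb_Rbar E) in *.
  (* [E] contains the segment from 0 to each of its points, hence every time strictly between its
     infimum and supremum. *)
  assert (Econv : forall s t, E s -> Rmin 0 s <= t <= Rmax 0 s -> E t).
  { intros s t (X & a & b & phi & sol & hs & _) ht.
    exists (phi t), a, b, phi; split; [|split]; trivial.
    apply (in_interval_between a b 0 s); trivial; apply sol. }
  assert (Eall : forall t, in_interval as_ bs t -> E t).
  { intros t [h1 h2]; apply NNPP; intros no.
    destruct (Rle_dec 0 t) as [p|p].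
    - apply (Rbar_lt_not_le _ _ h2), lub; intros s hs; simpl.
      apply Rnot_lt_le; intros l; apply no, (Econv s); trivial.
      rewrite Rmin_left, Rmax_right; lra.
    - apply (Rbar_lt_not_le _ _ h1), glb; intros s hs; simpl.
      apply Rnot_lt_le; intros l; apply no, (Econv s); trivial.
      rewrite Rmin_right, Rmax_left; lra. }
  (* A value is chosen at each time separately; uniqueness forces it to be the value of every
     solution defined at that time. *)
  set (phi t := epsilon (inhabits X0) (at_time t)).
  assert (agree : forall a b psi t, solution F X0 a b psi -> in_interval a b t ->
    phi t = psi t).
  { intros a b psi t sol ht.
    destruct (epsilon_spec (inhabits X0) (at_time t)) as (a' & b' & chi & sol' & ht' & e).
    - now exists (psi t), a, b, psi.
    - fold (phi t) in e; rewrite <- e.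
      now apply (quad_solution_unique
        a1 a2 a3 a4 a5 b1 b2 b3 b4 b5 X0 a' b' chi a b psi). }
  (* This yields maximality, and, applied to the local solution, that 0 lies strictly between the
     end points. *)
  assert (inside : forall a b psi, solution F X0 a b psi ->
    Rbar_le as_ a /\ Rbar_le b bs).
  { intros a b psi sol; assert (i0 := proj1 sol).
    assert (into : forall t, in_interval a b t -> E t)
      by now intros t ht; exists (psi t), a, b, psi.
    assert (ub0 := ub 0 E0); assert (lb0 := lbd 0 E0).
    split; apply Rbar_not_lt_le; intros l.
    - destruct i0 as [i1 i2].
      (* A time of the solution below the infimum of [E] is a contradiction; t <= 0 ensures that it
         also lies before b. *)
      assert (exists t : R, Rbar_lt a t /\ Rbar_lt t as_ /\ t <= 0) as (t & t1 & t2 & t3).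
      { destruct as_ as [g| |]; simpl in lb0, l; try easy;
        destruct a as [a| |]; simpl in i1, l; try easy.
        - exists ((a + g) / 2); simpl; lra.
        - exists (g - 1); simpl; lra. }
      apply (Rbar_lt_not_le _ _ t2), lbd, into; split; trivial.
      apply Rbar_le_lt_trans with 0; trivial.
    - destruct i0 as [i1 i2].
      assert (exists t : R, Rbar_lt t b /\ Rbar_lt bs t /\ 0 <= t) as (t & t1 & t2 & t3).
      { destruct bs as [g| |]; simpl in ub0, l; try easy;
        destruct b as [b| |]; simpl in i2, l; try easy.
        - exists ((b + g) / 2); simpl; lra.
        - exists (g + 1); simpl; lra. }
      apply (Rbar_lt_not_le _ _ t2), ub, into; split; trivial.
      apply Rbar_lt_le_trans with 0; trivial. }
  exists as_, bs, phi; split; [split; [|split]|].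
  - destruct (inside _ _ _ lsol) as [h1 h2]; destruct lsol as [[i1 i2] _].
    split; [eapply Rbar_le_lt_trans|eapply Rbar_lt_le_trans]; eassumption.
  - rewrite (agree la lb lphi); trivial; apply lsol.
  - intros t ht; destruct (Eall t ht) as (X & a & b & psi & sol & hab & _).
    rewrite (agree a b psi t) by trivial.
    destruct (proj2 (proj2 sol) t hab) as [dx dy].
    (* Differentiability is local, so it passes from [psi] to the glued function. *)
    assert (loc : locally t (fun s => psi s = phi s)).
    { apply (filter_imp (in_interval a b)); [|now apply locally_in_interval].
      intros s hs; symmetry; now apply (agree a b). }
    split; [apply (is_derive_ext_loc (fun s => fst (psi s)))
           |apply (is_derive_ext_loc (fun s => snd (psi s)))]; trivial;
      revert loc; apply filter_imp; now intros s ->.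
  - intros a' b' psi sol h1 h2 _; destruct (inside _ _ _ sol) as [h3 h4].
    split; apply Rbar_le_antisym; trivial.
Qed.

(** * Exponential scaling along solutions *)

(** A positive factor keeps the sign of the base, so each branch of [is_power] is preserved. On the
    negative branch, with k = p / q, the fraction is kept and (e^(kG))^q = e^(pG) = (e^G)^p. *)
Lemma is_power_mul_exp x k z G :
  is_power x k z -> is_power (x * exp G) k (z * exp (k * G)).
Proof.
  pose proof (exp_pos G) as hG.
  intros [[hx ->]|[[-> ->]|[hx (p & q & odd & hk & e)]]].
  - left; split; [now apply Rmult_lt_0_compat|].
    unfold Rpower; rewrite ln_mult, ln_exp, <- exp_plus by trivial.
    f_equal; ring.
  - right; left; lra.
  - right; right; split; [nra|].
    exists p, q; split; [|split]; trivial.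
    rewrite !Rpow_mult_distr, e; f_equal.
    rewrite <- !Rpower_pow by apply exp_pos.
    unfold Rpower; rewrite !ln_exp, <- hk; f_equal; ring.
Qed.

(** By the integrating factor: u(s) times e^(-cJ(s)), with J the integral of g from 0, has
    derivative zero. It serves for x with c = 1 and for y with c = k. *)
Lemma exp_RInt_solution (a b : Rbar) (u g : R -> R) (c t : R) :
  in_interval a b 0 -> in_interval a b t ->
  (forall s, in_interval a b s ->
     is_derive u s (c * (g s * u s)) /\ continuous g s) ->
  u t = u 0 * exp (c * RInt g 0 t).
Proof.
  intros h0 ht hu.
  set (J s := RInt g 0 s).
  assert (dJ : forall s, in_interval a b s -> is_derive J s (g s)).
  { intros s hs; apply (is_derive_RInt g J 0 s); [|now apply hu].
    apply (filter_imp (in_interval a b)); [|now apply locally_in_interval].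
    intros r hr; apply (RInt_correct (V := R_CompleteNormedModule) g 0 r).
    apply (ex_RInt_continuous g).
    intros z hz; apply hu, (in_interval_between a b 0 r); trivial. }
  set (w s := u s * exp (- (c * J s))).
  assert (dw : forall s, in_interval a b s -> is_derive w s 0).
  { intros s hs; destruct (hu s hs) as [du _]; pose proof (dJ s hs) as dj.
    unfold w; auto_derive; [repeat split; eexists; eassumption|].
    apply is_derive_unique in du, dj.
    change (fun x : R => u x) with u; change (fun x : R => J x) with J.
    rewrite du, dj; ring. }
  assert (e : w t = w 0).
  { destruct (MVT_gen w 0 t (fun _ => 0)) as (m & _ & e); [| |lra];
      intros s hs; [|eapply is_derive_continuity_pt];
      apply dw, (in_interval_between a b 0 t); trivial; lra. }
  unfold w in e.
  assert (J0 : J 0 = 0) by exact (RInt_point 0 g).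
  rewrite J0, Rmult_0_r, Ropp_0, exp_0, Rmult_1_r in e.
  rewrite <- e, Rmult_assoc, <- exp_plus; fold (J t).
  now rewrite Rplus_opp_l, exp_0, Rmult_1_r.
Qed.

(** * Tangency of the field to an invariant curve *)

Lemma power_curve_tangent a1 a2 a3 a4 a5 b1 b2 b3 b4 b5 k m x :
  flow_invariant (quadratic_field a1 a2 a3 a4 a5 b1 b2 b3 b4 b5) (power_curve m k) ->
  0 < x ->
  let y := m * Rpower x k in
  x * quad b1 b2 b3 b4 b5 x y = k * y * quad a1 a2 a3 a4 a5 x y.
Proof.
  cbn zeta; intros inv hx; set (y := m * Rpower x k).
  destruct (quad_maximal_solution_exists a1 a2 a3 a4 a5 b1 b2 b3 b4 b5 (x, y))
    as (a & b & phi & max).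
  assert (on : forall t, in_interval a b t -> power_curve m k (phi t)).
  { apply (inv (x, y)); trivial.
    exists (Rpower x k); split; [now left|reflexivity]. }
  destruct max as [(i0 & phi0 & d) _].
  destruct (d 0 i0) as [dx dy]; rewrite phi0 in dx, dy; cbn in dx, dy.
  (* Positivity of x near time 0 leaves only the [Rpower] branch of [is_power], which can be
     differentiated. *)
  assert (posx : locally 0 (fun t => 0 < fst (phi t))).
  { assert (c : continuous (fun t => fst (phi t)) 0)
      by (apply (ex_derive_continuous (fun t => fst (phi t))); eexists; exact dx).
    apply (c (fun z => 0 < z)).
    apply open_gt; now rewrite phi0. }
  assert (eqy : locally 0 (fun t => m * exp (k * ln (fst (phi t))) = snd (phi t))).
  { generalize (filter_and _ _ posx (locally_in_interval _ _ _ i0)).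
    apply filter_imp; intros t [hp ht].
    destruct (on t ht) as (z & [[_ ->]|[[h _]|[h _]]] & ->); [reflexivity|lra|lra]. }
  set (u := fun t => fst (phi t)) in *.
  assert (u0 : u 0 = x) by (unfold u; now rewrite phi0).
  assert (dy' : is_derive (fun t => m * exp (k * ln (u t))) 0
    (k * y / x * quad a1 a2 a3 a4 a5 x y)).
  { auto_derive.
    - rewrite u0; repeat split; trivial; eexists; exact dx.
    - replace (Derive (fun t : R => u t) 0) with (quad a1 a2 a3 a4 a5 x y)
        by (symmetry; now apply is_derive_unique).
      rewrite u0; unfold y, Rpower; field; lra. }
  apply (is_derive_ext_loc _ _ _ _ eqy) in dy'.
  apply is_derive_unique in dy, dy'; unfold quad in *.
  assert (e := eq_trans (eq_sym dy) dy').
  unfold pow in *; rewrite e; field; lra.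
Qed.

(** * Equivalence of invariance and the coefficient conditions *)

Theorem theorem3p8 (a1 a2 a3 a4 a5 b1 b2 b3 b4 b5 k : R) (hk : 0 < k) :
  (forall m : R,
     flow_invariant (quadratic_field a1 a2 a3 a4 a5 b1 b2 b3 b4 b5)
       (power_curve m k)) <->
  (b1 = 0 /\ b3 = 0 /\ a4 = 0 /\ a2 = 0 /\
   b4 = k * a5 /\ b5 = k * a3 /\ b2 = k * a1).
Proof.
  split.
  - intros inv.
    assert (T : forall m x, 0 < x ->
      let y := m * Rpower x k in
      x * quad b1 b2 b3 b4 b5 x y = k * y * quad a1 a2 a3 a4 a5 x y)
      by (intros m x; apply power_curve_tangent, inv).
    set (P := Rpower 2 k); assert (hP : 0 < P) by apply exp_pos.
    assert (P1 : Rpower 1 k = 1)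
      by (unfold Rpower; rewrite ln_1, Rmult_0_r; apply exp_0).
    (* Both sides are cubic polynomials in [m]; four values of [m] separate
       their coefficients. *)
    assert (cubic : forall c0 c1 c2 c3 : R,
      (forall m, c0 + c1 * m + c2 * m ^ 2 + c3 * m ^ 3 = 0) ->
      c0 = 0 /\ c1 = 0 /\ c2 = 0 /\ c3 = 0).
    { intros c0 c1 c2 c3 h.
      pose proof (h 0); pose proof (h 1); pose proof (h (-1)); pose proof (h 2).
      repeat split; lra. }
    (* Tangency at x = 1, where y = m. *)
    destruct (cubic (b1 + b3) (b2 + b5 - k * (a1 + a3)) (b4 - k * (a2 + a5))
      (- k * a4)) as (e0 & e1 & e2 & e3).
    { intros m; pose proof (T m 1 Rlt_0_1) as h; cbn zeta in h.
      rewrite P1 in h; unfold quad in h; nra. }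
    (* Tangency at x = 2, where y = m P, after division by 2; the powers of P > 0 cancel later. *)
    destruct (cubic (2 * b1 + 4 * b3)
      (P * (b2 + 2 * b5 - k * (a1 + 2 * a3)))
      (P * P * (b4 - k * (a2 / 2 + a5)))
      (- k * a4 * P * P * P / 2)) as (f0 & f1 & f2 & _).
    { intros m; pose proof (T m 2 Rlt_0_2) as h; cbn zeta in h.
      fold P in h; unfold quad in h; nra. }
    apply Rmult_integral in e3, f1, f2.
    assert (a4 = 0) by lra.
    assert (b2 + 2 * b5 - k * (a1 + 2 * a3) = 0) by lra.
    assert (b4 - k * (a2 / 2 + a5) = 0) by nra.
    (* The coefficients of m^2 at x = 1 and x = 2, the latter freed of P^2, differ by k a2 / 2. *)
    assert (k * a2 = 0) as z by lra.
    apply Rmult_integral in z.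
    assert (a2 = 0) by lra; subst a2.
    repeat split; lra.
  - intros (-> & -> & -> & -> & -> & -> & ->) m [x0 y0] a b phi.
    intros (z & hz & hy) [(i0 & phi0 & d) _] t ht; cbn in hz, hy; subst y0.
    set (g s := a1 + a3 * fst (phi s) + a5 * snd (phi s)).
    assert (cg : forall s, in_interval a b s -> continuous g s).
    { intros s hs; destruct (d s hs) as [dx dy].
      apply (ex_derive_continuous g); unfold g.
      set (x := fun s => fst (phi s)) in *; set (y := fun s => snd (phi s)) in *.
      change (ex_derive (fun s => a1 + a3 * x s + a5 * y s) s).
      auto_derive; repeat split; eexists; eassumption. }
    assert (ex : fst (phi t) = x0 * exp (RInt g 0 t)).
    { rewrite <- (Rmult_1_l (RInt g 0 t)).
      replace x0 with (fst (phi 0)) by now rewrite phi0.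
      apply (exp_RInt_solution a b (fun s => fst (phi s))); trivial.
      intros s hs; split; [|now apply cg].
      destruct (d s hs) as [dx _]; unfold g; destruct (phi s) as [xs ys].
      cbn in *; now replace (1 * ((a1 + a3 * xs + a5 * ys) * xs)) with
        (a1 * xs + 0 * ys + a3 * (xs * (xs * 1)) + 0 * (ys * (ys * 1)) + a5 * xs * ys)
        by ring. }
    assert (ey : snd (phi t) = m * z * exp (k * RInt g 0 t)).
    { replace (m * z) with (snd (phi 0)) by now rewrite phi0.
      apply (exp_RInt_solution a b (fun s => snd (phi s))); trivial.
      intros s hs; split; [|now apply cg].
      destruct (d s hs) as [_ dy]; unfold g; destruct (phi s) as [xs ys].
      cbn in *; now replace (k * ((a1 + a3 * xs + a5 * ys) * ys)) with
        (0 * xs + k * a1 * ys + 0 * (xs * (xs * 1)) + k * a5 * (ys * (ys * 1))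
         + k * a3 * xs * ys) by ring. }
    (* The witness rescales the initial power, so starting points with x = 0 or x < 0 are handled
       together with x > 0. *)
    exists (z * exp (k * RInt g 0 t)); split.
    + rewrite ex; now apply is_power_mul_exp.
    + rewrite ey; ring.
Qed.
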